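(* Let $n\le4$ and let $\Lambda_n^*$ be a lattice of rank $n$ in $\mathbb{R}^n$ whose shortest nonzero vectors have length $1$. Suppose the set $\Xi$ of shortest nonzero vectors has rank $n$ (i.e. spans $\mathbb{R}^n$). Then either $\Lambda_n^*$ is prime, or $n=4$ and, up to an orthogonal transformation of $\mathbb{R}^4$, $\Lambda_4^*$ is the lattice generated by the row vectors of $$\begin{pmatrix}1&0&0&0\\0&1&0&0\\0&0&1&0\\\frac12&\frac12&\frac12&\frac12\end{pmatrix}.$$
   Context: For a lattice $\Lambda_n^*$ of rank $n$, $\Xi$ denotes the set of its shortest nonzero vectors (taken up to sign). $\Lambda_n^*$ is called prime if it is generated by any $n$ linearly independent vectors in $\Xi$. *)

(* Defs.v *)
From mathcomp Require Import all_boot all_order all_algebra.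
From mathcomp Require Import classical_sets reals.

Set Implicit Arguments.
Unset Strict Implicit.
Unset Printing Implicit Defensive.

Import Order.TTheory GRing.Theory Num.Theory.

Local Open Scope ring_scope.
Local Open Scope classical_set_scope.

Section Lattices.
Context {R : realType}.

(* Euclidean length; the norm that the analysis library puts on matrices is the
   sup norm. *)
Definition enorm n (v : 'rV[R]_n) : R := Num.sqrt (\sum_i v 0 i ^+ 2).

Definition latgen m n (B : 'M[R]_(m, n)) : set 'rV[R]_n :=
  [set v | exists z : 'rV[int]_m, v = map_mx intr z *m B].

Definition full_lattice n (L : set 'rV[R]_n) : Prop :=
  exists B : 'M[R]_n, row_free B /\ L = latgen B.

(* Both v and -v are kept as representatives of a shortest vector taken up to
   sign: neither the span of the set, nor the linear independence of a family,
   nor the lattice the family generates depends on the signs. *)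
Definition shortest n (L : set 'rV[R]_n) : set 'rV[R]_n :=
  [set v | [/\ L v, v != 0 &
     forall w, L w -> w != 0 -> enorm v <= enorm w]].

Definition spans n (S : set 'rV[R]_n) : Prop :=
  forall v : 'rV[R]_n, exists (m : nat) (B : 'M[R]_(m, n)),
    (forall i, S (row i B)) /\ (v <= B)%MS.

Definition prime_lattice n (L : set 'rV[R]_n) : Prop :=
  forall B : 'M[R]_n,
    (forall i, shortest L (row i B)) -> row_free B -> L = latgen B.

Definition orthogonal_mx n (Q : 'M[R]_n) : Prop := Q *m Q^T = 1%:M.

Definition exceptional_mx : 'M[R]_4 :=
  \matrix_(i < 4, j < 4)
    nth 0 (nth [::] [:: [:: 1; 0; 0; 0];
                        [:: 0; 1; 0; 0];
                        [:: 0; 0; 1; 0];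
                        [:: 2^-1; 2^-1; 2^-1; 2^-1]] i) j.

End Lattices.

Arguments exceptional_mx : clear implicits.

(* Main.v *)
Require Import Defs.
From mathcomp Require Import all_boot all_order all_algebra.
From mathcomp Require Import classical_sets reals.
From mathcomp Require Import boolp ring lra.

(** Let [B] be a basis of the space made of unit vectors of [L], and let [v] in
    [L] lie outside the lattice generated by [B].  Rounding each coordinate of
    [v] on [B], of fractional part [f i], independently down or up with
    expectation equal to the coordinate, the mean squared length of the error is
    [\sum_i f i * (1 - f i) <= n / 4 <= 1], whereas every error is a nonzero
    vector of [L], hence of squared length at least [1].  So [n = 4], every [f i]
    is [1 / 2], and all the vectors [(+-b0 +-b1 +-b2 +-b3) / 2] are unit vectors,
    which makes [B] orthonormal. *)

Set Implicit Arguments.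
Unset Strict Implicit.
Unset Printing Implicit Defensive.

Import Order.TTheory GRing.Theory Num.Theory.

Local Open Scope ring_scope.
Local Open Scope classical_set_scope.

(** * Squared length and the rounding inequality *)

Section Rounding.
Context {R : realType}.

Definition sqnorm n (v : 'rV[R]_n) : R := \sum_i v 0 i ^+ 2.

Lemma sqnorm_ge0 n (v : 'rV[R]_n) : 0 <= sqnorm v.
Proof. by apply: sumr_ge0 => i _; rewrite sqr_ge0. Qed.

Lemma enorm_sqr n (v : 'rV[R]_n) : enorm v ^+ 2 = sqnorm v.
Proof. by rewrite sqr_sqrtr // sqnorm_ge0. Qed.

Lemma sqnorm_lincomb n (a b : R) (u w : 'rV[R]_n) :
  sqnorm (a *: u + b *: w) =
  a ^+ 2 * sqnorm u + b ^+ 2 * sqnorm w + 2 * a * b * (\sum_k u 0 k * w 0 k).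
Proof.
rewrite /sqnorm !mulr_sumr -!big_split /=; apply: eq_bigr => k _.
by rewrite !mxE; ring.
Qed.

(** Rounding [c] down with probability [1 - c] and up with probability [c] leaves an error of mean
    zero, so the inner product of [u] and [b] cancels and only the variance [c * (1 - c)] is
    added. *)
Lemma sqnorm_round n (c : R) (u b : 'rV[R]_n) :
  (1 - c) * sqnorm (u + c *: b) + c * sqnorm (u + (c - 1) *: b) =
  sqnorm u + c * (1 - c) * sqnorm b.
Proof. by rewrite -[u]scale1r !sqnorm_lincomb scale1r; ring. Qed.

(** If every choice of roundings gives squared length at least 1, so does their mean. The induction
    averages one index at a time; [u] is general so that it can absorb the errors already chosen. *)
Lemma rounding_bound (T : eqType) n (s : seq T) (b : T -> 'rV[R]_n)
    (c : T -> R) (u : 'rV[R]_n) :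
  uniq s -> (forall i, 0 <= c i <= 1) -> (forall i, sqnorm (b i) = 1) ->
  (forall e : T -> bool,
     1 <= sqnorm (u + \sum_(i <- s) (c i - (e i)%:R) *: b i)) ->
  1 <= sqnorm u + \sum_(i <- s) c i * (1 - c i).
Proof.
move=> + c01 b1; elim: s u => [|i s IHs] u /=.
  by move=> _ /(_ xpredT); rewrite !big_nil !addr0.
move=> /andP[iNs us] short; rewrite big_cons.
have step (x : bool) : 1 <= sqnorm (u + (c i - x%:R) *: b i) +
    \sum_(j <- s) c j * (1 - c j).
  apply: IHs => // e; rewrite -addrA.
  have := short (fun j => if j == i then x else e j).
  rewrite big_cons eqxx (eq_big_seq (fun j => (c j - (e j)%:R) *: b j)) //.
  by move=> j js; case: eqP => // ji; rewrite -ji js in iNs.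
(* The bounds [step false] and [step true] are averaged with weights [1 - c i] and [c i]. *)
have := sqnorm_round (c i) u (b i); rewrite b1 mulr1 addrA => <-.
have /= := step false; have /= := step true; rewrite subr0.
by have /andP[] := c01 i; nra.
Qed.

(** * Coordinates on a basis and generated lattices *)

Lemma row_free_coord n (B : 'M[R]_n) (v : 'rV[R]_n) :
  row_free B -> v = \sum_i (v *m invmx B) 0 i *: row i B.
Proof.
by move=> Bfree; rewrite -mulmx_sum_row mulmxKV // -row_free_unit.
Qed.

Lemma latgenP m n (B : 'M[R]_(m, n)) (v : 'rV[R]_n) :
  latgen B v <-> exists z : 'I_m -> int, v = \sum_i (z i)%:~R *: row i B.
Proof.
split=> [[z ->]|[z ->]].
  exists (z 0); rewrite mulmx_sum_row; apply: eq_bigr => i _; by rewrite mxE.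
exists (\row_i z i); rewrite mulmx_sum_row; apply: eq_bigr => i _.
by rewrite !mxE.
Qed.

Lemma latgenD m n (B : 'M[R]_(m, n)) (v w : 'rV[R]_n) :
  latgen B v -> latgen B w -> latgen B (v + w).
Proof.
move=> [y ->] [z ->]; exists (y + z).
by rewrite map_mxD mulmxDl.
Qed.

Lemma latgenZ m n (B : 'M[R]_(m, n)) (a : int) (v : 'rV[R]_n) :
  latgen B v -> latgen B (a%:~R *: v).
Proof.
by move=> [z ->]; exists (a *: z); rewrite map_mxZ /= scalemxAl.
Qed.

Lemma latgen_sub m k n (A : 'M[R]_(m, n)) (B : 'M[R]_(k, n)) :
  (forall i, latgen A (row i B)) -> latgen B `<=` latgen A.
Proof.
move=> AB v /latgenP[z ->]; elim/big_ind: _ => [|x y|i _].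
- by exists 0; rewrite map_mx0 mul0mx.
- exact: latgenD.
- exact: latgenZ.
Qed.

Lemma shortest_row n (L : set 'rV[R]_n) (B : 'M[R]_n) :
  (forall v, shortest L v -> enorm v = 1) ->
  (forall i, shortest L (row i B)) ->
  (forall i, sqnorm (row i B) = 1) /\
  (forall w, L w -> w != 0 -> 1 <= sqnorm w).
Proof.
move=> len1 Bshort; split=> [i|w Lw w0].
  by rewrite -enorm_sqr len1 // expr1n.
(* A nonzero [w] has an index [i], which provides a row of [B] to compare [w] with. *)
have /rV0Pn[i _] := w0.
have [_ _ /(_ w Lw w0)] := Bshort i; rewrite len1 // -enorm_sqr => w1.
exact: exprn_ege1.
Qed.

(** * Vectors of the lattice outside the sublattice of a basis *)

Section HalfCoset.
Variables (n : nat) (A B : 'M[R]_n).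
Hypotheses (n4 : (n <= 4)%N) (Bfree : row_free B).
Hypothesis BA : forall i, latgen A (row i B).
Hypothesis B1 : forall i, sqnorm (row i B) = 1.
Hypothesis A1 : forall w, latgen A w -> w != 0 -> 1 <= sqnorm w.

(** The error is [v] minus a vector of [latgen B]: it stays in [latgen A], and vanishes only if [v]
    is in [latgen B]. *)
Lemma unit_error (v : 'rV[R]_n) (z : 'I_n -> int) :
  latgen A v -> ~ latgen B v ->
  1 <= sqnorm (\sum_i ((v *m invmx B) 0 i - (z i)%:~R) *: row i B).
Proof.
move=> Av vNB; set w := \sum_i _.
have wE : w = v + (-1)%:~R *: \sum_i (z i)%:~R *: row i B.
  rewrite [X in X + _](row_free_coord v Bfree) scaleN1r -sumrB.
  by apply: eq_bigr => i _; rewrite scalerBl.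
have Bz : latgen B (\sum_i (z i)%:~R *: row i B) by apply/latgenP; exists z.
apply: A1.
  by rewrite wE; apply/latgenD/latgenZ => //; apply: latgen_sub Bz.
apply: contra_notN vNB; rewrite wE scaleN1r subr_eq0 => /eqP ->.
exact: Bz.
Qed.

Lemma half_coord (v : 'rV[R]_n) : latgen A v -> ~ latgen B v ->
  n = 4%N /\ forall i, (v *m invmx B) 0 i = (Num.floor ((v *m invmx B) 0 i))%:~R + 2^-1.
Proof.
move=> Av vNB; set c := v *m invmx B.
pose f i := c 0 i - (Num.floor (c 0 i))%:~R.
have f01 i : 0 <= f i <= 1.
  have := floor_le_tmp (c 0 i); have := lt_succ_floor (c 0 i).
  by rewrite intrD /f; lra.
have : 1 <= sqnorm (0 : 'rV[R]_n) + \sum_i f i * (1 - f i).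
  apply: (rounding_bound (b := fun i => row i B)) => // [|e].
    exact: index_enum_uniq.
  have := unit_error (fun i => Num.floor (c 0 i) + (e i)%:R) Av vNB.
  rewrite add0r; congr (_ <= sqnorm _); apply: eq_bigr => i _; congr (_ *: _).
  by rewrite intrD opprD addrA; case: (e i).
have -> : sqnorm (0 : 'rV[R]_n) = 0.
  by apply: big1 => i _; rewrite mxE expr0n.
(* Completing the square turns the bound into [1 <= n / 4 - \sum_i (f i - 2^-1) ^+ 2], which with
   [n <= 4] forces [n = 4] and a zero sum. *)
rewrite add0r (eq_bigr (fun i => 4^-1 - (f i - 2^-1) ^+ 2)); last first.
  by move=> i _; field.
rewrite sumrB sumr_const card_ord -[4^-1 *+ n]mulr_natr => lb.
have S0 : 0 <= \sum_i (f i - 2^-1) ^+ 2 by apply: sumr_ge0 => i _; exact: sqr_ge0.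
have n4R : n%:R <= 4 :> R by rewrite ler_nat.
have nE : n%:R = 4 :> R by lra.
split; first by apply/eqP; rewrite -(eqr_nat R); apply/eqP.
move=> i; have : \sum_i (f i - 2^-1) ^+ 2 == 0.
  by rewrite eq_le S0 andbT; move: lb; rewrite nE; lra.
rewrite psumr_eq0 => [/allP/(_ i (mem_index_enum _))|j _]; last exact: sqr_ge0.
by rewrite sqrf_eq0 /f => /eqP; lra.
Qed.

(** For [i != j], the signs of rows [i] and [j] are fixed and the two other rows are averaged out,
    at a cost of [1 / 4] each. So half the sum and half the difference of rows [i] and [j] both have
    squared length at least [1 / 2], and the inner product must be zero. *)
Lemma half_orthonormal (v : 'rV[R]_n) : latgen A v -> ~ latgen B v ->
  B *m B^T = 1%:M.
Proof.
move=> Av vNB; have [nE half] := half_coord Av vNB.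
have signs (e : 'I_n -> bool) :
    1 <= sqnorm (\sum_i (2^-1 - (e i)%:R) *: row i B).
  have := unit_error
    (fun i => Num.floor ((v *m invmx B) 0 i) + (e i)%:R) Av vNB.
  congr (_ <= sqnorm _); apply: eq_bigr => i _; congr (_ *: _).
  by rewrite {1}half intrD; case: (e i) => /=; lra.
apply/matrixP => i j; rewrite !mxE.
have -> : \sum_k B i k * B^T k j = \sum_k row i B 0 k * row j B 0 k.
  by apply: eq_bigr => k _; rewrite !mxE.
case: (eqVneq i j) => [<-|ij].
  by rewrite -(B1 i); apply: eq_bigr => k _; rewrite expr2.
pose s := [seq k <- index_enum 'I_n | (k != i) && (k != j)].
have sizes : size s = 2%N.
  rewrite size_filter -sum1_count.
  have : (\sum_(k < n) 1 = 4)%N by rewrite sum1_card card_ord.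
  by rewrite (bigD1 i) //= (bigD1 j) 1?eq_sym //= => -[].
have bound (x : bool) :
    1 <= sqnorm (2^-1 *: row i B + (2^-1 - x%:R) *: row j B) + 2^-1.
  rewrite [X in _ + X](_ : _ = \sum_(k <- s) 2^-1 * (1 - 2^-1)); last first.
    by rewrite big_const_seq count_predT sizes /=; field.
  apply: (rounding_bound (b := fun k => row k B)) => // [|k|e].
  - exact/filter_uniq/index_enum_uniq.
  - by apply/andP; split; lra.
  have := signs (fun k => if k == i then false else if k == j then x else e k).
  rewrite (bigD1 i) //= (bigD1 j) 1?eq_sym //= !eqxx eq_sym (negPf ij) subr0.
  rewrite big_filter addrA; congr (_ <= sqnorm (_ + _)).
  by apply: eq_bigr => k /andP[/negPf-> /negPf->].
have := bound true; have := bound false; rewrite !sqnorm_lincomb !B1 /=.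
by rewrite -[true%:R]/(1 : R) -[false%:R]/(0 : R); lra.
Qed.

End HalfCoset.

End Rounding.

(** * The exceptional lattice and the conclusion *)

Lemma exceptional_mxE (R : realType) (i j : 'I_4) :
  exceptional_mx R i j = if i == ord_max then 2^-1 else (i == j)%:R.
Proof.
rewrite mxE; case: i j => -[|[|[|[|//]]]] lt_i [] [|[|[|[|//]]]] lt_j;
  by rewrite -!val_eqE.
Qed.

(** These are the Hurwitz quaternions: the integer vectors and their translate by the all-halves
    vector, the parity of [a] telling which. *)
Lemma latgen_exceptional (R : realType) (c : 'rV[R]_4) :
  latgen (exceptional_mx R) c <->
  exists (y : 'I_4 -> int) (a : int),
    forall i, c 0 i = (y i)%:~R + a%:~R / 2.
Proof.
have coord (z : 'rV[int]_4) i : (map_mx intr z *m exceptional_mx R) 0 i =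
    (if i == ord_max then 0 else z 0 i)%:~R + (z 0 ord_max)%:~R / 2.
  rewrite mxE (bigD1 ord_max) //= exceptional_mxE eqxx mxE addrC; congr (_ + _).
  rewrite (eq_bigr (fun k => if k == i then (z 0 i)%:~R else 0)); last first.
    move=> k /negPf kmax; rewrite exceptional_mxE kmax mxE.
    by case: eqP => [->|_]; rewrite ?mulr1 ?mulr0.
  rewrite -big_mkcondr /=; case: eqP => [->|/eqP imax].
    by apply: big1 => k /andP[/negPf->].
  rewrite (big_pred1 i) // => k /=.
  by case: (eqVneq k i) => [->|]; rewrite ?imax ?andbF.
split=> [[z ->]|[y [a cE]]].
  by exists (fun i => if i == ord_max then 0 else z 0 i), (z 0 ord_max) => i.
(* Only the last generator reaches the last coordinate, which fixes its coefficient; its surplus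
   [y ord_max] is removed from the other coordinates. *)
exists (\row_i if i == ord_max then 2 * y ord_max + a else y i - y ord_max).
apply/rowP => i; rewrite coord cE !mxE eqxx.
by case: eqP => [->|_]; rewrite ?intrB intrD intrM /=; field.
Qed.

Lemma exceptional_sublattice (R : realType) (A B : 'M[R]_4) (v : 'rV[R]_4) :
  row_free B -> (forall i, latgen A (row i B)) ->
  (forall i, sqnorm (row i B) = 1) ->
  (forall w, latgen A w -> w != 0 -> 1 <= sqnorm w) ->
  latgen A v -> ~ latgen B v ->
  latgen A = [set c *m B | c in latgen (exceptional_mx R)].
Proof.
move=> Bfree BA B1 A1 Av vNB.
have half := half_coord (leqnn 4) Bfree BA B1 A1.
apply/seteqP; split=> [w Aw|_ [c /latgen_exceptional[y [a cE]] <-]].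
  exists (w *m invmx B); last by rewrite mulmxKV // -row_free_unit.
  apply/latgen_exceptional; have [[z ->]|wNB] := pselect (latgen B w).
    exists (z 0), 0 => i.
    by rewrite mulmxK -?row_free_unit // mxE mul0r addr0.
  have [_ wE] := half w Aw wNB.
  by eexists; exists 1 => i; rewrite wE mul1r.
have [_ vE] := half v Av vNB.
have AB (x : 'I_4 -> int) : latgen A (\sum_i (x i)%:~R *: row i B).
  by apply: (latgen_sub BA); apply/latgenP; exists x.
(* Subtracting from [v] its integer part on [B] leaves half the sum of the rows, the image of the
   last generator. *)
have -> : c *m B = \sum_i (y i)%:~R *: row i B + a%:~R *:
    (v + (-1)%:~R *: \sum_i (Num.floor ((v *m invmx B) 0 i))%:~R *: row i B).
  rewrite scaleN1r [X in X - _](row_free_coord v Bfree) -sumrB scaler_sumr.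
  rewrite -big_split mulmx_sum_row; apply: eq_bigr => i _ /=.
  by rewrite cE {1}vE -scalerBl addrAC subrr add0r scalerA -scalerDl.
by do ?[apply: latgenD | apply: latgenZ | apply: AB].
Qed.

Theorem theorem5p8 (R : realType) (n : nat) (hn : (n <= 4)%N)
    (L : set 'rV[R]_n) (hL : full_lattice L)
    (hlen : forall v, shortest L v -> enorm v = 1)
    (hspan : spans (shortest L)) :
  prime_lattice L \/
  exists (e : n = 4%N) (Q : 'M[R]_4),
    orthogonal_mx Q /\
    [set castmx (erefl 1%N, e) v | v in L] =
    [set v *m Q | v in latgen (exceptional_mx R)].
Proof.
case: hL => A [_ LA]; rewrite {}LA in hlen hspan *.
have [?|notprime] := pselect (prime_lattice (latgen A)); first by left.
right; move: notprime; rewrite /prime_lattice => /existsNP[B].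
move=> /not_implyP[Bshort /not_implyP[Bfree /eqP AB]].
have BA i : latgen A (row i B) by case: (Bshort i).
have [B1 A1] := shortest_row hlen Bshort.
have [v Av vNB] : exists2 v, latgen A v & ~ latgen B v.
  apply: contrapT => noV; move/eqP: AB; apply.
  apply/seteqP; split; last exact: latgen_sub.
  by move=> w Aw; apply: contrapT => wNB; apply: noV; exists w.
have [nE _] := half_coord hn Bfree BA B1 A1 Av vNB.
(* [B] itself, having orthonormal rows, is the orthogonal matrix. *)
exists nE; subst n; exists B; split.
  exact: half_orthonormal hn Bfree BA B1 A1 v Av vNB.
rewrite -(exceptional_sublattice Bfree BA B1 A1 Av vNB).
by rewrite -[RHS]image_id; apply: eq_imagel => w _; rewrite castmx_id.
Qed.
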